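(* Let $f : \mathbb{R}^n \to \mathbb{R}$ be a convex function which is $1$-smooth with respect to the seminorm $\|\cdot\|_B$, where $B$ is an $n \times n$ real symmetric positive semidefinite matrix. Let $x_0$ be a deterministic point in $\mathbb{R}^n$ and assume that the sublevel set $L_f(x_0) := \{x \in \mathbb{R}^n : f(x) \leq f(x_0)\}$ is bounded. Let $1 \leq \tau \leq \operatorname{Rank}(B)$, $K \geq 1$, and let $(x_k)_{k=1}^K$ be the random points in $\mathbb{R}^n$ generated by $\mathrm{RCDVS}(f, B, \tau, x_0, K)$. Then $$\mathbb{E} f(x_k) - \min f \leq \frac{2 D_\tau^2}{k+1}$$ for all $0 \leq k \leq K$, where $D_\tau := \max_{x \in L_f(x_0)} \min_{x^* \in \operatorname{Argmin} f} \|x - x^*\|_{B_\tau}$ is the radius of the sublevel set $L_f(x_0)$ measured in the norm $\|\cdot\|_{B_\tau}$.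
   Context: Notation: $\langle\cdot,\cdot\rangle$ is the standard inner product on $\mathbb{R}^n$; for a symmetric positive semidefinite matrix $B$, $\|v\|_B := \langle Bv, v\rangle^{1/2}$. $\operatorname{Argmin} f$ is the set of minimizers of $f$. A differentiable function $f:\mathbb{R}^n\to\mathbb{R}$ is $1$-smooth with respect to $\|\cdot\|_B$ if $f(y) \leq f(x) + \langle \nabla f(x), y-x\rangle + \frac12\|y-x\|_B^2$ for all $x,y\in\mathbb{R}^n$. $\binom{[n]}{\tau}$ is the collection of all $\tau$-element subsets of $[n]=\{1,\dots,n\}$. For $S \in \binom{[n]}{\tau}$, $I_S$ is the $n\times\tau$ matrix obtained from the $n\times n$ identity matrix $I$ by retaining only the columns with indices in $S$; $B_{S\times S} := I_S^T B I_S$; $v_S := I_S^T v$ for $v\in\mathbb{R}^n$. Volume sampling: for $B$ symmetric positive semidefinite and $1\le\tau\le\operatorname{Rank}(B)$, a random variable $S_0$ with values in $\binom{[n]}{\tau}$ satisfies $S_0\sim\mathrm{Vol}_\tau(B)$ if $\mathbb{P}(S_0=S) = \det(B_{S\times S}) / \sum_{S'\in\binom{[n]}{\tau}} \det(B_{S'\times S'})$ for all $S\in\binom{[n]}{\tau}$. $\mathrm{RCDVS}(f,B,\tau,x_0,K)$: for $k=0,\dots,K-1$, choose $S_k\sim\mathrm{Vol}_\tau(B)$ (independently of the previous choices) and set $x_{k+1} := x_k - I_{S_k}(B_{S_k\times S_k})^{-1}\nabla f(x_k)_{S_k}$. (The matrix $B_{S_k\times S_k}$ is invertible with probability one.) $\tau$-coordinate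 approximation: if $\lambda_1\ge\dots\ge\lambda_n$ are the eigenvalues of $B$ and $B = Q\operatorname{Diag}(\lambda_1,\dots,\lambda_n)Q^T$ with $Q$ orthogonal, then $B_\tau := Q\operatorname{Diag}(\lambda_1,\dots,\lambda_\tau,\lambda_\tau,\dots,\lambda_\tau)Q^T + \left(\sum_{i=\tau+1}^n\lambda_i\right) I$. For $1\le\tau\le\operatorname{Rank}(B)$ it is positive definite and does not depend on the choice of $Q$. *)

(* Defs.v *)
From HB Require Import structures.
From mathcomp Require Import all_boot all_order all_algebra.
From mathcomp Require Import all_classical all_reals all_analysis.

Set Implicit Arguments.
Unset Strict Implicit.
Unset Printing Implicit Defensive.

Import Order.TTheory GRing.Theory Num.Theory.
Import numFieldNormedType.Exports.

Local Open Scope classical_set_scope.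
Local Open Scope ring_scope.

Section LinearAlgebra.
Context {R : realType} {n : nat}.
Implicit Types (B : 'M[R]_n) (u v : 'cV[R]_n) (S : {set 'I_n}).

Definition inner u v : R := \sum_i u i 0 * v i 0.

Definition psd B : Prop := B^T = B /\ forall v, 0 <= inner (B *m v) v.

Definition seminorm B v : R := Num.sqrt (inner (B *m v) v).

(* The columns are listed in increasing order of their indices. *)
Definition colsel S : 'M[R]_(n, #|S|) := colsub (@enum_val _ (mem S)) 1%:M.

Definition submx_on B S : 'M[R]_#|S| := (colsel S)^T *m B *m colsel S.

Definition subvec_on v S : 'cV[R]_#|S| := (colsel S)^T *m v.

(* [lam] is indexed from 0: lambda_i is [lam`_i.-1], so that the i-th diagonal
   entry lambda_(min(i, tau)) reads [lam`_(minn i tau.-1)]. *)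
Definition is_coord_approx (tau : nat) B (A : 'M[R]_n) : Prop :=
  exists (Q : 'M[R]_n) (lam : n.-tuple R),
    [/\ Q^T *m Q = 1%:M,
        sorted >=%R lam,
        B = Q *m diag_mx (\row_(i < n) lam`_i) *m Q^T &
        A = Q *m diag_mx (\row_(i < n) lam`_(minn i tau.-1)) *m Q^T
            + (\sum_(tau <= i < n) lam`_i)%:M].

(* The tau-coordinate approximation B_tau. A spectral decomposition exists by
   the spectral theorem and the result does not depend on it, so the default
   value 0 is never reached for symmetric B. *)
Definition coord_approx (tau : nat) B : 'M[R]_n :=
  xget 0 [set A | is_coord_approx tau B A].

End LinearAlgebra.

(* Attained extrema: 0 when there is no greatest (least) element, otherwise
   that (unique) element. *)
Definition set_max {R : realType} (A : set R) : R := xget 0 (A `&` ubound A).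
Definition set_min {R : realType} (A : set R) : R := xget 0 (A `&` lbound A).

Section Optimization.
Context {R : realType} {n : nat}.
Implicit Types (f : 'cV[R]_n -> R) (B : 'M[R]_n).

Definition grad f (x : 'cV[R]_n) : 'cV[R]_n :=
  \col_i 'D_(delta_mx i 0) f x.

Definition one_smooth f B : Prop :=
  (forall x, differentiable f x) /\
  forall x y,
    f y <= f x + inner (grad f x) (y - x) + 2^-1 * seminorm B (y - x) ^+ 2.

Definition sublevel f (x0 : 'cV[R]_n) : set 'cV[R]_n :=
  [set x | f x <= f x0].

Definition Argmin f : set 'cV[R]_n := [set x | forall y, f x <= f y].

Definition sublevel_radius f (x0 : 'cV[R]_n) (A : 'M[R]_n) : R :=
  set_max [set set_min [set seminorm A (x - xs) | xs in Argmin f]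
          | x in sublevel f x0].

(* On a singular block [invmx] returns the block itself; under volume sampling
   this branch has probability zero. *)
Definition rcd_step f B (x : 'cV[R]_n) (S : {set 'I_n}) : 'cV[R]_n :=
  x - colsel S *m invmx (submx_on B S) *m subvec_on (grad f x) S.

End Optimization.

(* Finite sets over a finite type, with the discrete sigma-algebra. *)
HB.instance Definition _ (I : finType) :=
  isPointed.Build {set I} (finset.set0 : {set I}).
HB.instance Definition _ (I : finType) :=
  @isMeasurable.Build default_measure_display {set I} discrete_measurable
    discrete_measurable0 discrete_measurableC discrete_measurableU.

Section Sampling.
Context {d : measure_display} {T : measurableType d} {R : realType}.
Variable P : probability T R.

Definition mutually_independent {d' : measure_display}
    {T' : measurableType d'} {K : nat} (X : 'I_K -> {RV P >-> T'}) : Prop :=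
  forall (J : {set 'I_K}) (A : 'I_K -> set T'),
    (forall k, measurable (A k)) ->
    P (\bigcap_(k in [set` J]) (X k @^-1` A k)) =
    (\prod_(k in J) P (X k @^-1` A k))%E.

Definition vol_sampling {n : nat} (B : 'M[R]_n) (tau : nat)
    (S : {RV P >-> {set 'I_n}}) : Prop :=
  (forall w, #|S w| = tau) /\
  forall A : {set 'I_n}, #|A| = tau ->
    P (S @^-1` [set A]) =
    (\det (submx_on B A)
     / \sum_(A' : {set 'I_n} | #|A'| == tau) \det (submx_on B A'))%:E.

(* Only S_0, ..., S_(K-1) and x_0, ..., x_K are constrained. *)
Definition RCDVS {n : nat} (f : 'cV[R]_n -> R) (B : 'M[R]_n) (tau : nat)
    (x0 : 'cV[R]_n) (K : nat) (S : nat -> {RV P >-> {set 'I_n}})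
    (x : nat -> T -> 'cV[R]_n) : Prop :=
  [/\ forall k, (k < K)%N -> vol_sampling B tau (S k),
      mutually_independent (fun k : 'I_K => S k),
      forall w, x 0%N w = x0 &
      forall k w, (k < K)%N -> x k.+1 w = rcd_step f B (x k w) (S k w)].

End Sampling.

(* Main.v *)
(* Write lambda for the eigenvalues of B and e_k for the elementary symmetric
   polynomials, so that e_tau(lambda) is the sum of the principal tau-minors of B;
   let g be the gradient at x, S a volume sample and u = Q^T g.

   A step on the block S decreases f by at least half of g_S^T (B_SS)^{-1} g_S.
   Since det (B + g g^T)_SS = det B_SS * (1 + g_S^T (B_SS)^{-1} g_S), and since sums
   of principal minors are invariant under orthogonal conjugation, the mean of this
   gain is (sum_i u_i^2 e_{tau-1}(lambda without lambda_i)) / e_tau(lambda).  Singular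
   blocks are harmless: f is bounded below, hence g is orthogonal to ker B and
   det (B + g g^T)_SS vanishes together with det B_SS.  The i-th eigenvalue c_i of
   B_tau satisfies e_tau(lambda) <= c_i e_{tau-1}(lambda without lambda_i), so the
   mean gain is at least g^T B_tau^{-1} g.

   Convexity and Young's inequality then give, for every s > 0 and every x in the
   sublevel set, f x - min f <= s (f x - E f(x_next)) + D^2 / (2 s).  This is linear
   in f, so it passes to expectations without Jensen's inequality, and s = (k+2)/2
   makes k (k+1) (E f(x_k) - min f) - 2 D^2 k nonincreasing. *)

Require Import Defs.
From mathcomp Require Import all_boot all_order all_algebra finmap.
From mathcomp Require Import all_classical all_reals all_analysis.
From mathcomp Require Import perm ring lra.
Import Order.TTheory GRing.Theory Num.Theory.
Import numFieldNormedType.Exports.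
Local Open Scope classical_set_scope.
Local Open Scope ring_scope.
Set Implicit Arguments.
Unset Strict Implicit.
Unset Printing Implicit Defensive.

(** * Principal minors *)

(** Sylvester's identity: both sides are the determinant of one 2 by 2 block matrix, factored into
    block triangular matrices in two ways. *)
Lemma det_1addM (F : comPzRingType) (m n : nat) (U : 'M[F]_(m, n)) (V : 'M[F]_(n, m)) :
  \det (1%:M + U *m V) = \det (1%:M + V *m U).
Proof.
have -> : \det (1%:M + U *m V) = \det (block_mx 1%:M (- U) V 1%:M).
  have -> : block_mx 1%:M (- U) V 1%:M =
      block_mx (1%:M + U *m V) (- U) 0 1%:M *m block_mx 1%:M 0 V 1%:M.
    rewrite mulmx_block !mulmx1 !mul0mx !mulmx0 mul1mx !add0r mulNmx.
    by rewrite addrK.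
  by rewrite det_mulmx det_ublock det_lblock !det1 !mulr1.
have -> : block_mx 1%:M (- U) V 1%:M =
    block_mx 1%:M 0 V 1%:M *m block_mx 1%:M (- U) 0 (1%:M + V *m U).
  rewrite mulmx_block !mul0mx !mulmx0 !mul1mx !mulmx1 !addr0 mulmxN.
  by rewrite addrC addrK.
by rewrite det_mulmx det_ublock det_lblock !det1 !mul1r.
Qed.

(** A full-size stand-in for the principal block on [J]: it has the same determinant and needs no
    reindexing by [enum_val]. *)
Definition row_restrict (F : pzRingType) (n : nat) (J : {set 'I_n}) (A : 'M[F]_n) : 'M[F]_n :=
  \matrix_(i, j) if i \in J then A i j else (i == j)%:R.

(** In the Leibniz formula each product of binomials is expanded; [J] records the rows where the
    term with 'X is taken. *)
Lemma det_1addXM (F : comNzRingType) (n : nat) (A : 'M[F]_n) :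
  \det (1%:M + 'X *: map_mx polyC A) =
  \sum_(J : {set 'I_n}) (\det (row_restrict J A))%:P * 'X^#|J|.
Proof.
rewrite /determinant.
under [RHS]eq_bigr => J _ do rewrite raddf_sum mulr_suml.
rewrite [RHS]exchange_big /=; apply: eq_bigr => s _.

have -> : \prod_i (1%:M + 'X *: map_mx polyC A) i (s i) =
    \prod_i ('X * (A i (s i))%:P + ((i == s i)%:R)%:P).
  
  apply: eq_bigr => i _; rewrite !mxE addrC; congr (_ + _).
  by case: eqP; rewrite ?polyC1 ?polyC0.
rewrite bigA_distr mulr_sumr; apply: eq_bigr => J _.
rewrite polyCM rmorphXn rmorphN1 -mulrA; congr (_ * _).
rewrite rmorph_prod -prodr_const (big_mkcond (fun i => i \in J) (fun=> 'X)) -big_split /=.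
apply: eq_bigr => i _; rewrite mxE; case: ifP => _; last by rewrite mulr1.
by rewrite mulrC.
Qed.

Lemma coef_det_1addXM (F : comNzRingType) (n t : nat) (A : 'M[F]_n) :
  (\det (1%:M + 'X *: map_mx polyC A))`_t =
  \sum_(J : {set 'I_n} | #|J| == t) \det (row_restrict J A).
Proof.
rewrite det_1addXM coef_sum [RHS]big_mkcond /=; apply: eq_bigr => J _.
by rewrite coefCM coefXn eq_sym; case: eqP; rewrite ?mulr1 ?mulr0.
Qed.

Section Colsel.
Variables (R : realType) (n : nat) (J : {set 'I_n}).

Lemma colselE i k : colsel J i k = (i == enum_val k)%:R :> R.
Proof. by rewrite !mxE. Qed.

Lemma colsel_orth : (colsel J)^T *m colsel J = 1%:M :> 'M[R]_#|J|.
Proof.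
apply/matrixP => k l; rewrite !mxE (bigD1 (enum_val k)) //= big1 ?addr0.
  by rewrite mxE !colselE eqxx mul1r (inj_eq enum_val_inj).
by move=> i /negPf ik; rewrite mxE colselE ik mul0r.
Qed.

Lemma colsel_proj (A : 'M[R]_n) :
  colsel J *m ((colsel J)^T *m A) = \matrix_(i, j) if i \in J then A i j else 0.
Proof.
apply/matrixP => i j; rewrite !mxE; case: ifPn => iJ.
  rewrite (bigD1 (enum_rank_in iJ i)) //= big1 ?addr0.
    rewrite colselE enum_rankK_in // eqxx mul1r mxE (bigD1 i) //= big1 ?addr0.
      by rewrite mxE colselE enum_rankK_in // eqxx mul1r.
    by move=> k /negPf ki; rewrite mxE colselE enum_rankK_in // ki mul0r.
  move=> k ki; rewrite colselE; case: eqP => [e|]; last by rewrite mul0r.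
  by move/eqP: ki => []; apply: enum_val_inj; rewrite enum_rankK_in.
apply: big1 => k _; rewrite colselE; case: eqP => [e|]; last by rewrite mul0r.
by move: iJ; rewrite e enum_valP.
Qed.

(* Sylvester's identity moves the determinant of the principal block to the
   full-size matrix, with no reordering of the indices. *)
Lemma det_row_restrict (A : 'M[R]_n) :
  \det (row_restrict J A) = \det (submx_on A J).
Proof.
have -> : row_restrict J A = 1%:M + colsel J *m ((colsel J)^T *m (A - 1%:M)).
  rewrite colsel_proj; apply/matrixP => i j; rewrite !mxE; case: ifP => _.
    by rewrite addrC subrK.
  by rewrite addr0.
rewrite det_1addM mulmxBr mulmxBl -mulmxA mulmx1 colsel_orth /submx_on mulmxA.
by rewrite addrC subrK.
Qed.

End Colsel.

Lemma coef_det_minors (R : realType) (n t : nat) (A : 'M[R]_n) :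
  (\det (1%:M + 'X *: map_mx polyC A))`_t =
  \sum_(J : {set 'I_n} | #|J| == t) \det (submx_on A J).
Proof. by rewrite coef_det_1addXM; apply: eq_bigr => J _; exact: det_row_restrict. Qed.

(** The sum is a coefficient of det (1 + X A), a polynomial unchanged when [A] is conjugated by an
    orthogonal matrix. *)
Lemma sum_minors_similar (R : realType) (n t : nat) (Q A : 'M[R]_n) :
  Q^T *m Q = 1%:M ->
  \sum_(J : {set 'I_n} | #|J| == t) \det (submx_on (Q *m A *m Q^T) J) =
  \sum_(J : {set 'I_n} | #|J| == t) \det (submx_on A J).
Proof.
move=> QQ; rewrite -!coef_det_minors; congr (_`_t).
have := QQ; move/mulmx1C => QQ'.
have -> : 1%:M + 'X *: map_mx polyC (Q *m A *m Q^T) =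
  map_mx polyC Q *m (1%:M + 'X *: map_mx polyC A) *m map_mx polyC Q^T.
  rewrite mulmxDr mulmxDl mulmx1 -map_mxM QQ' map_mx1; congr (_ + _).
  by rewrite -scalemxAr -scalemxAl -!map_mxM.
by rewrite !det_mulmx mulrAC -det_mulmx -map_mxM QQ' map_mx1 det1 mul1r.
Qed.

Lemma det_diag_minor (R : realType) (n : nat) (J : {set 'I_n}) (l : 'rV[R]_n) :
  \det (submx_on (diag_mx l) J) = \prod_(i in J) l 0 i.
Proof.
rewrite -det_row_restrict.
have -> : row_restrict J (diag_mx l) = diag_mx (\row_i if i \in J then l 0 i else 1).
  by apply/matrixP => i j; rewrite !mxE; case: ifP.
by rewrite det_diag [RHS]big_mkcond; apply: eq_bigr => i _; rewrite mxE.
Qed.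

(** * Rank-one updates of determinants *)

Lemma det_1addcr (F : comPzRingType) (n : nat) (u : 'cV[F]_n) (v : 'rV[F]_n) :
  \det (1%:M + u *m v) = 1 + (v *m u) 0 0.
Proof. by rewrite det_1addM [LHS]det_mx11 !mxE eqxx. Qed.

Lemma det_rank1_update (F : comUnitRingType) (n : nat) (A : 'M[F]_n) (u : 'cV[F]_n) :
  A \in unitmx ->
  \det (A + u *m u^T) = \det A * (1 + (u^T *m invmx A *m u) 0 0).
Proof.
move=> uA; have -> : A + u *m u^T = A *m (1%:M + (invmx A *m u) *m u^T).
  by rewrite mulmxDr mulmx1 !mulmxA mulmxV // mul1mx.
by rewrite det_mulmx det_1addcr mulmxA.
Qed.

Lemma det_diag_add (F : comPzRingType) (n : nat) (l : 'rV[F]_n) (A : 'M[F]_n) :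
  \det (diag_mx l + A) =
  \sum_(J : {set 'I_n}) (\prod_(i in ~: J) l 0 i) * \det (row_restrict J A).
Proof.
rewrite /determinant.
under [RHS]eq_bigr => J _ do rewrite mulr_sumr.
rewrite [RHS]exchange_big /=; apply: eq_bigr => s _.
have -> : \prod_i (diag_mx l + A) i (s i) =
    \prod_i (A i (s i) + (i == s i)%:R * l 0 i).
  by apply: eq_bigr => i _; rewrite !mxE addrC mulr_natl.
rewrite bigA_distr mulr_sumr; apply: eq_bigr => J _.
rewrite mulrCA; congr (_ * _).
rewrite [in RHS]big_mkcond -big_split /=.
apply: eq_bigr => i _; rewrite mxE finset.in_setC; case: ifP => _ /=.
  by rewrite mul1r.
by rewrite mulrC.
Qed.

Lemma det_row_restrict1 (F : comPzRingType) (n : nat) (i : 'I_n) (A : 'M[F]_n) :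
  \det (row_restrict (finset.set1 i) A) = A i i.
Proof.
have -> : row_restrict (finset.set1 i) A = 1%:M + delta_mx i 0 *m (row i A - delta_mx 0 i).
  apply/matrixP => j k; rewrite !mxE big_ord1 !mxE finset.in_set1 !eqxx andbT.
  case: eqP => [->|_]; last by rewrite mul0r addr0.
  by rewrite mul1r [k == i]eq_sym addrC subrK.
rewrite det_1addcr mxE (bigD1 i) //= big1 ?addr0.
  by rewrite !mxE !eqxx mulr1 [LHS]addrC subrK.
by move=> j /negPf ji; rewrite [delta_mx _ _ _ _]mxE ji mulr0.
Qed.

Lemma det_row_restrict_rank1 (R : realType) (n : nat) (J : {set 'I_n})
    (a : 'cV[R]_n) (b : 'rV[R]_n) :
  (1 < #|J|)%N -> \det (row_restrict J (a *m b)) = 0.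
Proof.
move=> J2; apply/eqP; rewrite det_row_restrict; apply: contraLR J2.
rewrite -unitfE -[_ \is a _]/(_ \in unitmx) -row_free_unit -leqNgt => /eqP {1}<-.
rewrite /submx_on mulmxA -mulmxA.
exact: leq_trans (mxrankM_maxl _ _) (rank_leq_col _).
Qed.

(** In the expansion over [J] only the empty set and the singletons survive, since larger blocks of
    a rank-one matrix are singular. No entry of [l] has to be invertible. *)
Lemma det_diag_rank1 (R : realType) (n : nat) (l : 'rV[R]_n)
    (a : 'cV[R]_n) (b : 'rV[R]_n) :
  \det (diag_mx l + a *m b) =
  \prod_i l 0 i + \sum_i a i 0 * b 0 i * \prod_(j | j != i) l 0 j.
Proof.
rewrite det_diag_add (bigID (fun J : {set 'I_n} => #|J| == 0%N)) /=; congr (_ + _).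
  rewrite (big_pred1 finset.set0) => [|J]; last by rewrite cards_eq0.
  rewrite finset.setC0 (_ : row_restrict _ _ = 1%:M); last first.
    by apply/matrixP => i j; rewrite !mxE finset.in_set0.
  by rewrite det1 mulr1; apply: eq_bigl => i; rewrite finset.in_setT.
rewrite (bigID (fun J : {set 'I_n} => #|J| == 1%N)) /= [X in _ + X]big1 ?addr0; last first.
  move=> J /andP[J0 J1]; rewrite det_row_restrict_rank1 ?mulr0 //.
  by case: #|J| J0 J1 => [|[]].
transitivity (\sum_i \sum_(J : {set 'I_n} | J == finset.set1 i)
   (\prod_(j in ~: J) l 0 j) * \det (row_restrict J (a *m b))).
  rewrite (exchange_big_dep xpredT) //= [LHS]big_mkcond; apply: eq_bigr => J _.
  case: ifPn => [/andP[_ /cards1P[i ->]]|].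
    rewrite [RHS](big_pred1 i) // => j; rewrite eq_sym.
    by apply/eqP/eqP => [/finset.set1_inj|->].
  rewrite negb_and negbK => J1; rewrite [RHS]big_pred0 // => i; apply/eqP => Ji.
  by move: J1; rewrite Ji cards1.
apply: eq_bigr => i _; rewrite big_pred1_eq det_row_restrict1 mulrC.
rewrite mxE big_ord1; congr (_ * _).
by apply: eq_bigl => j; rewrite !finset.inE.
Qed.

(** Replacing rows by identity rows keeps the shape diagonal plus rank one, so the full-size formula
    applies. *)
Lemma det_minor_diag_rank1 (R : realType) (n : nat) (l : 'rV[R]_n)
    (u : 'cV[R]_n) (J : {set 'I_n}) :
  \det (submx_on (diag_mx l + u *m u^T) J) =
  \prod_(i in J) l 0 i + \sum_(i in J) u i 0 ^+ 2 * \prod_(j in J :\ i) l 0 j.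
Proof.
rewrite -det_row_restrict.
pose lJ := \row_i if i \in J then l 0 i else 1.
have -> : row_restrict J (diag_mx l + u *m u^T) =
    diag_mx lJ + (\col_i if i \in J then u i 0 else 0) *m u^T.
  apply/matrixP => i j; rewrite !mxE !big_ord1 !mxE.
  by case: ifP => // _; rewrite mul0r addr0.
rewrite det_diag_rank1 [in RHS]big_mkcond [in X in _ = _ + X]big_mkcond; congr (_ + _).
  by apply: eq_bigr => i _; rewrite mxE.
apply: eq_bigr => i _; rewrite !mxE; case: ifP => iJ; last by rewrite !mul0r.
rewrite -expr2; congr (_ * _); rewrite big_mkcond [RHS]big_mkcond.
apply: eq_bigr => j _; rewrite !finset.inE mxE.
by case: (j != i); case: (j \in J).
Qed.

(** * Subset sums and elementary symmetric polynomials *)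

Lemma sum_setD1 (I : finType) (V : nmodType) (t : nat) (i : I) (Q : pred {set I})
    (F : {set I} -> V) :
  \sum_(J : {set I} | [&& #|J| == t.+1, i \in J & Q (J :\ i)]) F (J :\ i) =
  \sum_(U : {set I} | [&& #|U| == t, i \notin U & Q U]) F U.
Proof.
rewrite [RHS](reindex_onto (fun J : {set I} => J :\ i) (fun U => i |: U)) /=; last first.
  by move=> U /and3P[_ iU _]; rewrite finset.setU1K.
apply: eq_big => // J; rewrite finset.setD11 /=.
case: (boolP (i \in J)) => iJ.
  by rewrite finset.setD1K // eqxx andbT (cardsD1 i J) iJ.
rewrite andbF; apply/esym/negbTE; apply: contra iJ => /andP[_ /eqP <-].
exact: finset.setU11.
Qed.

Lemma sum_setD1_all (I : finType) (V : nmodType) (t : nat) (i : I) (F : {set I} -> V) :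
  \sum_(J : {set I} | (#|J| == t.+1) && (i \in J)) F (J :\ i) =
  \sum_(U : {set I} | (#|U| == t) && (i \notin U)) F U.
Proof.
have := sum_setD1 t i xpredT F; under eq_bigl => J do rewrite andbT.
by move=> ->; apply: eq_bigl => U; rewrite andbT.
Qed.

(** The elementary symmetric polynomial e_t with the i-th variable omitted, which is the i-th
    partial derivative of e_(t+1). *)
Definition esym_but (R : realType) (n t : nat) (l : 'rV[R]_n) (i : 'I_n) : R :=
  \sum_(U : {set 'I_n} | (#|U| == t) && (i \notin U)) \prod_(j in U) l 0 j.

Lemma sum_minors_diag_rank1 (R : realType) (n t : nat) (l : 'rV[R]_n) (u : 'cV[R]_n) :
  \sum_(J : {set 'I_n} | #|J| == t.+1) \det (submx_on (diag_mx l + u *m u^T) J) =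
  \sum_(J : {set 'I_n} | #|J| == t.+1) \det (submx_on (diag_mx l) J)
  + \sum_i u i 0 ^+ 2 * esym_but t l i.
Proof.
under eq_bigr => J _ do rewrite det_minor_diag_rank1.
rewrite big_split /=; congr (_ + _).
  by apply: eq_bigr => J _; rewrite det_diag_minor.
rewrite (exchange_big_dep xpredT) //=; apply: eq_bigr => i _.
rewrite -mulr_sumr; congr (_ * _).
exact: (sum_setD1_all t i (fun U => \prod_(j in U) l 0 j)).
Qed.

Lemma card_ord_lt (n m : nat) : (#|[set j : 'I_n | (j < m)%N]%SET| <= m)%N.
Proof.
rewrite cardE -(size_map val) -[leqRHS](size_iota 0); apply: uniq_leq_size.
  by rewrite (map_inj_uniq val_inj) enum_uniq.
by move=> k /mapP[j]; rewrite mem_enum finset.inE mem_iota => jm ->.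
Qed.

(** Pigeonhole: otherwise [J] would lie among the first [t + (i <= t)] indices with [i] removed, and
    these number at most [t]. The threshold rises by one exactly when [i] occupies one of the small
    positions. *)
Lemma ex_large_index (n t : nat) (i : 'I_n) (J : {set 'I_n}) :
  #|J| = t.+1 -> i \notin J ->
  exists2 j, j \in J & (j != i) && (t + (i <= t) <= j)%N.
Proof.
move=> Jt iJ; apply/exists_inP; apply: contraT => /exists_inPn nJ.
have JA : J \subset [set j : 'I_n | (j < t + (i <= t))%N]%SET :\ i.
  apply/fintype.subsetP => j jJ; have := nJ _ jJ; rewrite !finset.inE.
  have -> : j != i by apply: contraNneq iJ => <-.
  by rewrite /= -ltnNge.
have := subset_leq_card JA; rewrite Jt leqNgt => /negP[]; rewrite ltnS.
have := card_ord_lt n (t + (i <= t)); rewrite (cardsD1 i) finset.inE.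
have [it|it] := boolP (i <= t)%N.
  by rewrite addn1 ltnS it add1n ltnS.
by rewrite addn0 (ltnNge i) (ltnW (_ : t < i)%N) // ltnNge.
Qed.

(* A (t+1)-subset missing [i] has an element [j] with a large index, and for each
   fixed [j] removing it maps these subsets injectively to those counted by
   [esym_but t l i]. *)
Lemma esym_le (R : realType) (n t : nat) (l : 'rV[R]_n) (i : 'I_n) :
  (forall j, 0 <= l 0 j) ->
  \sum_(J : {set 'I_n} | #|J| == t.+1) \prod_(j in J) l 0 j <=
  (l 0 i + \sum_(j < n | (j != i) && (t + (i <= t) <= j)%N) l 0 j) * esym_but t l i.
Proof.
move=> l0; pose D j := (j != i) && (t + (i <= t) <= j)%N.
have prod0 (A : {set 'I_n}) : 0 <= \prod_(j in A) l 0 j by exact: prodr_ge0.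
(* Sets containing [i] give the term with [l 0 i]; the others are bounded by the sum over [j]. *)
rewrite mulrDl (bigID (fun J : {set 'I_n} => i \in J)) /=; apply: lerD.
  rewrite /esym_but -sum_setD1_all mulr_sumr; apply: ler_sum => J /andP[_ iJ].
  by rewrite (big_setD1 i).
apply: (@le_trans _ _ (\sum_(J : {set 'I_n} | (#|J| == t.+1) && (i \notin J))
    \sum_(j | D j && (j \in J)) l 0 j * \prod_(k in J :\ j) l 0 k)).
  apply: ler_sum => J /andP[/eqP Jt iJ].
  have [j jJ Dj] := ex_large_index Jt iJ.
  rewrite [leRHS](bigD1 j) /=; last by rewrite /D Dj jJ.
  rewrite [leLHS](big_setD1 j jJ) /= lerDl.
  by apply: sumr_ge0 => k _; exact: mulr_ge0.
rewrite (exchange_big_dep D) /=; last by move=> J j _ /andP[].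
rewrite mulr_suml; apply: ler_sum => j Dj.
rewrite -mulr_sumr; apply: ler_wpM2l => //.
have ji : j != i by case/andP: Dj.
rewrite (eq_bigl (fun J : {set 'I_n} => [&& #|J| == t.+1, j \in J & i \notin J :\ j])); last first.
  by move=> J; rewrite Dj /= finset.in_setD1 [i == j]eq_sym ji /= -andbA [X in _ && X]andbC.
rewrite (sum_setD1 t j (fun U => i \notin U) (fun U => \prod_(k in U) l 0 k)).
rewrite /esym_but [leRHS](bigID (fun U : {set 'I_n} => j \notin U)) /=.
rewrite [leLHS](eq_bigl (fun U : {set 'I_n} => (#|U| == t) && (i \notin U) && (j \notin U))); last first.
  by move=> U; rewrite -andbA [X in _ && X]andbC.
by rewrite lerDl; apply: sumr_ge0.
Qed.

(** * Mean gain under volume sampling *)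

(** At s = -a / (c + 1) the quadratic is negative unless a = 0; using c + 1 instead of c covers c =
    0. *)
Lemma linear_coef_eq0 (F : realFieldType) (a c : F) :
  0 <= c -> (forall s, 0 <= 2 * s * a + s ^+ 2 * c) -> a = 0.
Proof.
move=> c0 /(_ (- a / (c + 1))).
have -> : 2 * (- a / (c + 1)) * a + (- a / (c + 1)) ^+ 2 * c =
    - (a ^+ 2 * ((c + 2) / (c + 1) ^+ 2)) by field; lra.
rewrite oppr_ge0 => ha; apply/eqP; rewrite -sqrf_eq0 eq_le sqr_ge0 andbT.
have c1 : 0 < (c + 2) / (c + 1) ^+ 2 by rewrite divr_gt0 ?exprn_gt0; lra.
by move: ha; rewrite pmulr_lle0.
Qed.

Section Inner.
Variables (R : realType) (n : nat).
Implicit Types (u v w : 'cV[R]_n) (A B : 'M[R]_n).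

Lemma innerE u v : inner u v = (u^T *m v) 0 0.
Proof. by rewrite mxE; apply: eq_bigr => i _; rewrite mxE. Qed.

Lemma innerC u v : inner u v = inner v u.
Proof. by apply: eq_bigr => i _; rewrite mulrC. Qed.

Lemma innerDl u v w : inner (u + v) w = inner u w + inner v w.
Proof. by rewrite !innerE linearD mulmxDl mxE. Qed.

Lemma innerZl (a : R) u v : inner (a *: u) v = a * inner u v.
Proof. by rewrite !innerE linearZ -scalemxAl mxE. Qed.

Lemma innerNl u v : inner (- u) v = - inner u v.
Proof. by rewrite -scaleN1r innerZl mulN1r. Qed.

Lemma innerDr u v w : inner u (v + w) = inner u v + inner u w.
Proof. by rewrite innerC innerDl !(innerC u). Qed.

Lemma innerZr (a : R) u v : inner u (a *: v) = a * inner u v.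
Proof. by rewrite innerC innerZl innerC. Qed.

Lemma innerNr u v : inner u (- v) = - inner u v.
Proof. by rewrite innerC innerNl innerC. Qed.

Lemma inner_mulmx A u v : inner (A *m u) v = inner u (A^T *m v).
Proof. by rewrite !innerE trmx_mul mulmxA. Qed.

Lemma inner_ge0 u : 0 <= inner u u.
Proof. by apply: sumr_ge0 => i _; rewrite -expr2 sqr_ge0. Qed.

Lemma inner_eq0 u : (inner u u == 0) = (u == 0).
Proof.
apply/idP/eqP => [|->]; last by rewrite /inner big1 // => i _; rewrite mxE mul0r.
rewrite psumr_eq0 => [/allP u0|i _]; last by rewrite -expr2 sqr_ge0.
apply/matrixP => i j; rewrite ord1 mxE.
by have := u0 i (mem_index_enum i); rewrite /= mulf_eq0 orbb => /eqP.
Qed.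

(** Along the line v + s B v the form is a nonnegative quadratic in s without constant term, whose
    linear coefficient is twice the squared norm of B v. *)
Lemma psd_ker B v : psd B -> inner (B *m v) v = 0 -> B *m v = 0.
Proof.
move=> [symB posB] Bv0; apply/eqP; rewrite -inner_eq0.
set a := inner _ _; set c := inner (B *m (B *m v)) (B *m v).
have c0 : 0 <= c := posB _.
have pos s : 0 <= 2 * s * a + s ^+ 2 * c.
  have := posB (v + s *: (B *m v)).
  rewrite mulmxDr -scalemxAr !innerDl !innerDr !innerZl !innerZr Bv0 add0r.
  rewrite [inner (B *m (B *m v)) v]inner_mulmx symB -/a -/c.
  by congr (_ <= _); ring.
by rewrite (linear_coef_eq0 c0 pos).
Qed.

End Inner.

Section VolumeIdentity.
Variables (R : realType) (n : nat) (B : 'M[R]_n) (g : 'cV[R]_n).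
Hypotheses (psdB : psd B) (g_orth : forall z, B *m z = 0 -> inner g z = 0).

(** Twice the guaranteed decrease of [f] for a step on [J]. On a singular block the value is a
    default, and the sums below multiply it by the vanishing determinant. *)
Definition step_gain (J : {set 'I_n}) : R :=
  ((subvec_on g J)^T *m invmx (submx_on B J) *m subvec_on g J) 0 0.

Lemma det_minor_rank1 (J : {set 'I_n}) :
  \det (submx_on (B + g *m g^T) J) =
  \det (submx_on B J) * (1 + step_gain J).
Proof.
have -> : submx_on (B + g *m g^T) J =
    submx_on B J + subvec_on g J *m (subvec_on g J)^T.
  by rewrite /submx_on /subvec_on mulmxDr mulmxDl trmx_mul trmxK !mulmxA.
have [uB|] := boolP (submx_on B J \in unitmx); first exact: det_rank1_update.
(* A left null vector of the singular block B_SS extends to a kernel vector of B. *)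
rewrite unitmxE unitfE negbK => /eqP detB; rewrite detB mul0r.
have /eqP/det0P[z z0 zB] := detB.
apply/eqP/det0P; exists z => //; rewrite mulmxDr zB add0r.
pose w := colsel J *m z^T : 'cV[R]_n.
have Bw : B *m w = 0.
  apply: psd_ker => //; rewrite innerE trmx_mul -mulmxA.
  have -> : w^T *m (B^T *m w) = z *m submx_on B J *m z^T.
    by rewrite psdB.1 /w trmx_mul trmxK /submx_on !mulmxA.
  by rewrite zB mul0mx mxE.
have := g_orth Bw; rewrite innerC innerE /w trmx_mul trmxK -mulmxA => zg.
by rewrite mulmxA [z *m _]mx11_scalar zg mul_scalar_mx scale0r.
Qed.

(** The minors of B + g g^T are summed in two ways, block by block and in the eigenbasis of B; the
    minors of B itself cancel. *)
Lemma sum_step_gain (t : nat) (Q : 'M[R]_n) (l : 'rV[R]_n) :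
  Q^T *m Q = 1%:M -> B = Q *m diag_mx l *m Q^T ->
  \sum_(J : {set 'I_n} | #|J| == t.+1) \det (submx_on B J) * step_gain J =
  \sum_i (Q^T *m g) i 0 ^+ 2 * esym_but t l i.
Proof.
move=> QQ BE; have QQ' := mulmx1C QQ.
set u := Q^T *m g.
have gE : B + g *m g^T = Q *m (diag_mx l + u *m u^T) *m Q^T.
  by rewrite mulmxDr mulmxDl -BE /u trmx_mul trmxK !mulmxA QQ' mul1mx -!mulmxA QQ' mulmx1.
have := sum_minors_diag_rank1 t l u.
rewrite -(sum_minors_similar t.+1 _ QQ) -gE -(sum_minors_similar t.+1 (diag_mx l) QQ) -BE.
under eq_bigr => J _ do rewrite det_minor_rank1 mulrDr mulr1.
by rewrite big_split => /addrI.
Qed.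

Lemma sum_minorsE (t : nat) (Q : 'M[R]_n) (l : 'rV[R]_n) :
  Q^T *m Q = 1%:M -> B = Q *m diag_mx l *m Q^T ->
  \sum_(J : {set 'I_n} | #|J| == t) \det (submx_on B J) =
  \sum_(J : {set 'I_n} | #|J| == t) \prod_(j in J) l 0 j.
Proof.
move=> QQ ->; rewrite sum_minors_similar //; apply: eq_bigr => J _.
exact: det_diag_minor.
Qed.

Lemma psd_eigen_ge0 (Q : 'M[R]_n) (l : 'rV[R]_n) j :
  Q^T *m Q = 1%:M -> B = Q *m diag_mx l *m Q^T -> 0 <= l 0 j.
Proof.
move=> QQ BE; have := psdB.2 (Q *m delta_mx j 0).
rewrite innerC innerE trmx_mul BE !mulmxA -(mulmxA _ Q^T Q) QQ mulmx1.
rewrite -(mulmxA _ Q^T Q) QQ mulmx1 trmx_delta -rowE -colE !mxE eqxx.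
by rewrite mulr1n.
Qed.

End VolumeIdentity.

(** * Eigenvalues of the coordinate approximation *)

Section CoordApprox.
Variables (R : realType) (n t : nat) (B A Q : 'M[R]_n) (lam : n.-tuple R).
Hypotheses (psdB : psd B) (QQ : Q^T *m Q = 1%:M).
Hypothesis BE : B = Q *m diag_mx (\row_(i < n) lam`_i) *m Q^T.
Hypothesis AE : A = Q *m diag_mx (\row_(i < n) lam`_(minn i t)) *m Q^T
                    + (\sum_(t.+1 <= i < n) lam`_i)%:M.

Let l : 'rV[R]_n := \row_(i < n) lam`_i.

(** The eigenvalue c_i of B_tau, where [t] is tau - 1. *)
Definition approx_eigen (i : 'I_n) : R := lam`_(minn i t) + \sum_(t.+1 <= j < n) lam`_j.

(** This is the form that [esym_le] bounds. For i <= t the tail already omits i; for i > t the entry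
    at index t extends the tail down to t, and the i-th entry is split off from it. *)
Lemma approx_eigenE (i : 'I_n) :
  approx_eigen i = l 0 i + \sum_(j < n | (j != i) && (t + (i <= t) <= j)%N) l 0 j.
Proof.
rewrite /approx_eigen mxE; under [in RHS]eq_bigr => j _ do rewrite mxE.
case: (leqP i t) => it.
  rewrite big_geq_mkord; congr (_ + _); apply: eq_bigl => j.
  rewrite addn1 /=; case: leqP; rewrite ?andbF ?andbT // => tj.
  by apply/esym/eqP => ji; move: tj; rewrite ji ltnNge it.
rewrite addn0 -(@big_ltn _ _ _ t n (fun j => lam`_j)) ?(ltn_trans it) //.
rewrite big_geq_mkord (bigD1 i) //=; last exact: ltnW.
by congr (_ + _); apply: eq_bigl => j; rewrite andbC.
Qed.

Lemma eigen_ge0 j : 0 <= l 0 j.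
Proof. exact: (psd_eigen_ge0 psdB (l := l) j QQ BE). Qed.

Lemma approx_eigen_ge0 i : 0 <= approx_eigen i.
Proof. by rewrite approx_eigenE addr_ge0 ?sumr_ge0 // => *; exact: eigen_ge0. Qed.

Lemma inner_coord_approx y :
  inner (A *m y) y = \sum_i approx_eigen i * (Q^T *m y) i 0 ^+ 2.
Proof.
rewrite AE mulmxDl innerDl mul_scalar_mx innerZl.
have -> : inner y y = inner (Q^T *m y) (Q^T *m y).
  by rewrite inner_mulmx trmxK mulmxA (mulmx1C QQ) mul1mx.
rewrite -!mulmxA inner_mulmx /inner mulr_sumr -big_split /=; apply: eq_bigr => i _.
rewrite mul_diag_mx !mxE /approx_eigen; ring.
Qed.

Lemma inner_coord_approx_ge0 y : 0 <= inner (A *m y) y.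
Proof.
rewrite inner_coord_approx; apply: sumr_ge0 => i _.
by rewrite mulr_ge0 ?sqr_ge0 // approx_eigen_ge0.
Qed.

(** Multiplied by 2 s m, the difference of the two sides is (s m u - z)^2 + (c m - 1) z^2. *)
Lemma young_weighted (F : realFieldType) (s u z m c : F) :
  0 < s -> 0 <= c -> 0 <= m -> 1 <= c * m ->
  u * z <= s / 2 * (u ^+ 2 * m) + (2 * s)^-1 * (c * z ^+ 2).
Proof.
move=> s0 c0 m0 cm; have mp : 0 < m.
  by rewrite lt_neqAle m0 andbT eq_sym; apply: contraTneq cm => ->; lra.
have sm : 0 < 2 * (s * m) by rewrite !mulr_gt0.
rewrite -subr_ge0 -(pmulr_rge0 _ sm).
have -> : 2 * (s * m) * (s / 2 * (u ^+ 2 * m) + (2 * s)^-1 * (c * z ^+ 2) - u * z) =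
  (s * m * u - z) ^+ 2 + (c * m - 1) * z ^+ 2 by field; lra.
by apply: addr_ge0; rewrite ?sqr_ge0 // mulr_ge0 ?sqr_ge0 ?subr_ge0.
Qed.

(** Young's inequality is applied coordinatewise in the eigenbasis, with c the eigenvalue of B_tau
    and m = [esym_but t l i / E]; the condition 1 <= c m is [esym_le]. The inverse of B_tau never
    appears. *)
Lemma inner_le_gain (g y : 'cV[R]_n) (s : R) :
  let E := \sum_(J : {set 'I_n} | #|J| == t.+1) \det (submx_on B J) in
  E != 0 -> (forall z, B *m z = 0 -> inner g z = 0) -> 0 < s ->
  inner g y <=
    s / 2 * \sum_(J : {set 'I_n} | #|J| == t.+1) \det (submx_on B J) / E * step_gain B g J
    + (2 * s)^-1 * seminorm A y ^+ 2.
Proof.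
move=> E E0 g_orth s0.
have EE : E = \sum_(J : {set 'I_n} | #|J| == t.+1) \prod_(j in J) l 0 j.
  by rewrite /E (sum_minorsE _ QQ BE).
have Egt0 : 0 < E.
  rewrite lt_neqAle eq_sym E0 EE sumr_ge0 // => J _.
  by apply: prodr_ge0 => j _; exact: eigen_ge0.
rewrite sqr_sqrtr ?inner_coord_approx_ge0 // inner_coord_approx.
under eq_bigr => J _ do rewrite mulrAC.
rewrite -mulr_suml (sum_step_gain psdB g_orth _ QQ BE).
have -> : inner g y = inner (Q^T *m g) (Q^T *m y).
  by rewrite inner_mulmx trmxK mulmxA (mulmx1C QQ) mul1mx.
rewrite mulr_suml !mulr_sumr -big_split; apply: ler_sum => i _ /=.
rewrite -(mulrA _ _ E^-1); apply: young_weighted => //.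
- exact: approx_eigen_ge0.
- rewrite divr_ge0 ?(ltW Egt0) //; apply: sumr_ge0 => U _.
  by apply: prodr_ge0 => j _; exact: eigen_ge0.
- rewrite mulrA ler_pdivlMr // mul1r approx_eigenE EE; apply: esym_le.
  exact: eigen_ge0.
Qed.

End CoordApprox.

(** * Real spectral theorem *)

Section VectorTopology.
Variables (R : realType).

Lemma mx_entry_le (m n : nat) (M : 'M[R]_(m, n)) i j : `|M i j| <= `|M|.
Proof.
rewrite {2}/Num.norm /= mx_normrE; apply/bigmax_geP; right.
by exists (i, j).
Qed.

Lemma mx_norm_le (m n : nat) (M : 'M[R]_(m, n)) (c : R) :
  0 <= c -> (forall i j, `|M i j| <= c) -> `|M| <= c.
Proof.
move=> c0 Mc; rewrite /Num.norm /= mx_normrE.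
by apply/bigmax_leP; split => // -[i j] _; exact: Mc.
Qed.

Lemma trmx_continuous (m n : nat) : continuous (@trmx R m n).
Proof.
move=> M P [Q nQ QP]; exists (fun i j => Q j i) => [i j|N NQ].
  by have := nQ j i; rewrite mxE.
by apply: QP => i j; rewrite mxE; exact: NQ.
Qed.

(** Transposition is continuous and keeps entry bounds, so Heine-Borel for row vectors carries
    over. *)
Lemma bounded_closed_compact_cV (n : nat) (A : set 'cV[R]_n) :
  bounded_set A -> closed A -> compact A.
Proof.
move=> [M [Mreal AM]] clA.
have -> : A = trmx @` [set v : 'rV[R]_n | A v^T].
  apply/seteqP; split => [v Av|_ [v Av <-]] //.
  by exists v^T; rewrite /= trmxK.
apply: continuous_compact; first exact/continuous_subspaceT/trmx_continuous.
apply: bounded_closed_compact.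
  exists M; split => // x Mx v /= /(AM _ Mx) vx; apply: le_trans vx => /=.
  by apply: mx_norm_le => // i j; have := mx_entry_le v^T j i; rewrite mxE.
by apply: (preimage_closed _ clA) => v _; exact: trmx_continuous.
Qed.

Lemma continuous_sum (T : topologicalType) (I : Type) (r : seq I) (F : I -> T -> R) :
  (forall i, continuous (F i)) -> continuous (fun x => \sum_(i <- r) F i x).
Proof.
move=> cF; elim: r => [|i r IH] x.
  by under eq_fun do rewrite big_nil; exact: cvg_cst.
by under eq_fun do rewrite big_cons; apply: cvgD; [exact: cF|exact: IH].
Qed.

Lemma inner_continuous (T : topologicalType) (n : nat) (f g : T -> 'cV[R]_n) :
  continuous f -> continuous g -> continuous (fun x => inner (f x) (g x)).
Proof.
move=> cf cg; apply: continuous_sum => i x.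
have ci : continuous (fun v : 'cV[R]_n => v i 0) by exact: coord_continuous.
by apply: cvgM; [exact: (continuous_comp (cf x) (ci _))|
                 exact: (continuous_comp (cg x) (ci _))].
Qed.

Lemma quadratic_continuous (n : nat) (A : 'M[R]_n) :
  continuous (fun v : 'cV[R]_n => inner (A *m v) v).
Proof.
have cc i : continuous (fun w : 'cV[R]_n => w i 0) by exact: coord_continuous.
have cA i : continuous (fun w : 'cV[R]_n => (A *m w) i 0).
  have -> : (fun w : 'cV[R]_n => (A *m w) i 0) = fun w => \sum_j A i j * w j 0.
    by apply/funext => w; rewrite mxE.
  by apply: continuous_sum => j w; apply: (cvgM _ (cc j w)); exact: cvg_cst.
by apply: continuous_sum => i v; apply: (cvgM (cA i v) (cc i v)).
Qed.

Lemma entry_le_inner (n : nat) (v : 'cV[R]_n) i : v i 0 ^+ 2 <= inner v v.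
Proof.
rewrite /inner (bigD1 i) //= -expr2 lerDl; apply: sumr_ge0 => j _.
by rewrite -expr2 sqr_ge0.
Qed.

Lemma compact_sphere (n : nat) : compact [set v : 'cV[R]_n | inner v v = 1].
Proof.
apply: bounded_closed_compact_cV.
  exists 1; split => // x x1 v /= v1; apply: (le_trans _ (ltW x1)).
  apply: mx_norm_le => // i j; rewrite ord1 -(ler_pXn2r (_ : 0 < 2)%N) ?nnegrE //.
  by rewrite real_normK ?num_real // expr1n -v1 entry_le_inner.
have -> : [set v : 'cV[R]_n | inner v v = 1] =
    (fun v : 'cV[R]_n => inner v v) @^-1` [set 1] by [].
apply: preimage_closed; last exact: closed_eq.
by move=> v _; apply: inner_continuous => w; exact: cvg_id.
Qed.

End VectorTopology.

Section Spectral.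
Variable R : realType.

(** Take [v] maximizing the quadratic form on the unit sphere, with value [lam]. By homogeneity
    [lam%:M - A] is positive semidefinite, and its form vanishes at [v], so [psd_ker] makes [v] an
    eigenvector. *)
Lemma rayleigh_max (n : nat) (A : 'M[R]_n.+1) : A^T = A ->
  exists (lam : R) (v : 'cV[R]_n.+1),
    [/\ inner v v = 1, A *m v = lam *: v & psd (lam%:M - A)].
Proof.
move=> symA; pose S := [set v : 'cV[R]_n.+1 | inner v v = 1].
have normE (w : 'cV[R]_n.+1) : w != 0 -> inner w w != 0 by rewrite inner_eq0.
have S0 : S !=set0.
  exists (delta_mx 0 0); rewrite /S /= /inner (bigD1 ord0) //= big1 ?addr0.
    by rewrite !mxE eqxx mulr1.
  by move=> i /negPf i0; rewrite !mxE i0 mul0r.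
have [v vS vmax] := compact_EVT_max S0 (@compact_sphere R n.+1)
  (continuous_subspaceT (@quadratic_continuous R n.+1 A)).
have v1 : inner v v = 1 by move: vS; rewrite inE.
set lam := inner (A *m v) v in vmax.
have psdL : psd (lam%:M - A).
  split; first by rewrite linearB /= tr_scalar_mx symA.
  move=> w; rewrite mulmxBl mul_scalar_mx innerDl innerNl innerZl subr_ge0.
  have [->|w0] := eqVneq w 0; first by rewrite mulmx0 !innerE mulmx0 mxE mulr0.
  have c0 : 0 < inner w w by rewrite lt_neqAle eq_sym normE // inner_ge0.
  set a := Num.sqrt (inner w w).
  have a2 : a * a = inner w w by rewrite -expr2 sqr_sqrtr // ltW.
  have a0 : a != 0 by rewrite gt_eqF // sqrtr_gt0.
  have := vmax (a^-1 *: w); rewrite inE /S /= -scalemxAr !innerZl !innerZr.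
  have -> : a^-1 * (a^-1 * inner w w) = 1 by rewrite -a2; field.
  move=> /(_ erefl); rewrite mulrA -invfM a2 mulrC ler_pdivrMr //.
exists lam, v; split=> //.
have := psd_ker psdL (v := v).
rewrite mulmxBl mul_scalar_mx innerDl innerNl innerZl v1 mulr1 subrr => /(_ erefl).
by move/subr0_eq.
Qed.

(* The Householder reflection exchanging [v] and the first basis vector. *)
Lemma ex_orthogonal_first_col (n : nat) (v : 'cV[R]_n.+1) : inner v v = 1 ->
  exists H : 'M[R]_n.+1, H^T *m H = 1%:M /\ H *m delta_mx 0 0 = v.
Proof.
move=> v1; pose e : 'cV[R]_n.+1 := delta_mx 0 0; set w := v - e.
have e1 : inner e e = 1.
  rewrite /inner (bigD1 ord0) //= big1 ?addr0; first by rewrite !mxE eqxx mulr1.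
  by move=> i /negPf i0; rewrite !mxE i0 mul0r.
have [w0|w0] := eqVneq w 0.
  exists 1%:M; rewrite trmx1 mul1mx; split => //; rewrite mul1mx.
  by apply/esym/subr0_eq.
have c0 : inner w w != 0 by rewrite inner_eq0.
pose H : 'M[R]_n.+1 := 1%:M - (2 / inner w w) *: (w *m w^T).
have HE x : H *m x = x - (2 / inner w w * inner w x) *: w.
  rewrite /H mulmxBl mul1mx -scalemxAl -mulmxA -scalerA; congr (_ - _ *: _).
  by rewrite [w^T *m x]mx11_scalar mul_mx_scalar innerE.
exists H; split.
  have -> : H^T = H.
    by rewrite /H linearB linearZ /= trmx_mul trmxK trmx1.
  rewrite {2}/H mulmxBr mulmx1 -scalemxAr mulmxA HE.
  have -> : 2 / inner w w * inner w w = 2 by field.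
  have -> : w - 2 *: w = - w by rewrite scaler_nat mulr2n opprD addrA subrr add0r.
  by rewrite mulNmx scalerN opprK /H subrK.
(* As v and e are unit vectors, the squared norm of w = v - e is -2 times its product with e; hence
   H e = e + w = v. *)
rewrite HE -/e; have -> : 2 / inner w w * inner w e = - 1.
  have -> : inner w w = - 2 * inner w e.
    by rewrite /w !innerDl !innerDr !innerNl !innerNr v1 e1 (innerC e v); ring.
  have : inner w e != 0; last by move=> we; field.
  apply: contraNneq c0 => we.
  have : inner w w = - 2 * inner w e.
    by rewrite /w !innerDl !innerDr !innerNl !innerNr v1 e1 (innerC e v); ring.
  by rewrite we mulr0 => ->.
by rewrite scaleN1r opprK /w addrC subrK.
Qed.

(** Induction by deflation: conjugating by an orthogonal matrix whose first column is a top
    eigenvector leaves a block diagonal matrix. *)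
Lemma spectral_sorted (n : nat) (A : 'M[R]_n) : A^T = A ->
  exists (Q : 'M[R]_n) (lam : n.-tuple R),
    [/\ Q^T *m Q = 1%:M, sorted >=%R lam &
        A = Q *m diag_mx (\row_(i < n) lam`_i) *m Q^T].
Proof.
elim: n A => [|n IH] A symA.
  by exists 1%:M, [tuple]; split => //; rewrite ?trmx1 ?mulmx1 // flatmx0 [RHS]flatmx0.
have [mu [v [v1 Av psdL]]] := rayleigh_max symA.
have [H [HH Hv]] := ex_orthogonal_first_col v1.
have HH' := mulmx1C HH.
have [A1 A1def] : exists A1 : 'M[R]_(1 + n), A1 = H^T *m A *m H by eexists.
have A1e : A1 *m delta_mx 0 0 = mu *: delta_mx 0 0 :> 'cV[R]_(1 + n).
  rewrite A1def -!mulmxA (_ : H *m delta_mx 0 0 = v); last exact: Hv.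
  by rewrite Av -scalemxAr -Hv mulmxA HH mul1mx.
have symA1 : A1^T = A1 by rewrite A1def !trmx_mul trmxK symA mulmxA.
have A1c i : A1 i 0 = mu * (i == 0)%:R.
  by have := congr1 (fun M : 'cV[R]_(1 + n) => M i 0) A1e; rewrite -colE !mxE eqxx andbT.
have A1r i : A1 0 i = mu * (i == 0)%:R by rewrite -A1c -[in RHS]symA1 mxE.
have A1E : A1 = block_mx mu%:M 0 0 (drsubmx A1).
  rewrite -[LHS]submxK; congr block_mx; apply/matrixP => i j.
  - by rewrite !mxE !ord1 lshift0 A1c eqxx mulr1.
  - by rewrite !mxE !ord1 lshift0 A1r mulr0.
  - by rewrite !mxE !ord1 lshift0 A1c mulr0.
have [|Q [lam [QQ slam QE]]] := IH (drsubmx A1).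
  by rewrite -[in RHS]symA1 trmx_drsub.
pose Q1 : 'M[R]_(1 + n) := block_mx 1%:M 0 0 Q.
have Q1T : Q1^T = block_mx 1%:M 0 0 Q^T.
  by rewrite tr_block_mx trmx1 !trmx0.
have Q1Q1 : Q1^T *m Q1 = 1%:M.
  rewrite Q1T /Q1 mulmx_block.
  by rewrite !mul1mx !mulmx0 !mul0mx !addr0 !add0r QQ -scalar_mx_block.
have Q1A1 : Q1 *m block_mx (diag_mx mu%:M) 0 0 (diag_mx (\row_i lam`_i)) *m Q1^T = A1.
  rewrite Q1T /Q1 !mulmx_block.
  rewrite !mul1mx !mulmx0 !mul0mx !mulmx1 !addr0 !add0r -QE [RHS]A1E.
  congr block_mx; rewrite ?addr0 ?mul0mx //.
  by apply/matrixP => i j; rewrite !mxE !ord1.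
have HQ : (H *m Q1)^T *m (H *m Q1) = 1%:M.
  by rewrite trmx_mul mulmxA -(mulmxA _ H^T) HH mulmx1 -[RHS]Q1Q1.
have DE : diag_mx (\row_(i < 1 + n) [tuple of mu :: lam]`_i) =
    block_mx (diag_mx mu%:M) 0 0 (diag_mx (\row_i lam`_i)).
  rewrite -diag_mx_row; congr diag_mx.
  apply/rowP => i; rewrite !mxE; case: splitP => j ij; rewrite !mxE ij.
    by rewrite ord1 eqxx.
  by rewrite add1n.
have AE : A = H *m Q1 *m diag_mx (\row_(i < n.+1) [tuple of mu :: lam]`_i) *m (H *m Q1)^T.
  rewrite trmx_mul !mulmxA -(mulmxA H) -(mulmxA H).
  rewrite [X in H *m X](_ : _ = A1) ?A1def; last by rewrite -A1def -Q1A1 -DE.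
  by rewrite !mulmxA HH' mul1mx -mulmxA HH' mulmx1.
exists (H *m Q1), [tuple of mu :: lam]; split=> //=.
rewrite path_sortedE; last by move=> y x z /= yx zy; exact: le_trans zy yx.
rewrite slam andbT; apply/(all_nthP 0) => i; rewrite size_tuple => ilam.
(* Sortedness: the eigenvalues of the positive semidefinite matrix [mu%:M - A] are the differences
   with [mu], so [mu] dominates [lam]. *)
have LE : mu%:M - A = (H *m Q1) *m
   diag_mx (\row_(i < n.+1) (mu - [tuple of mu :: lam]`_i)) *m (H *m Q1)^T.
  have -> : diag_mx (\row_(i < n.+1) (mu - [tuple of mu :: lam]`_i)) =
     mu%:M - diag_mx (\row_(i < n.+1) [tuple of mu :: lam]`_i).
    by apply/matrixP => j k; rewrite !mxE mulrnBl.
  rewrite mulmxBr mulmxBl -AE mul_mx_scalar -scalemxAl (mulmx1C HQ).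
  by rewrite scalemx1.
have := psd_eigen_ge0 psdL (Ordinal (ilam : (i.+1 < n.+1)%N)) HQ LE.
by rewrite mxE /= subr_ge0.
Qed.

End Spectral.

(** * Convexity and smoothness *)

Section Gradient.
Variables (R : realType) (n : nat) (f : 'cV[R]_n -> R) (B : 'M[R]_n).
Implicit Types x y z v : 'cV[R]_n.

Lemma derive_grad x v : differentiable f x -> 'D_v f x = inner (grad f x) v.
Proof.
move=> df; rewrite deriveE // {1}[v]matrix_sum_delta linear_sum /inner.
apply: eq_bigr => i _; rewrite big_ord1 linearZ /= mxE deriveE // mulrC.
by [].
Qed.

(** Convexity bounds the difference quotients with step in (0, 1] by [f y - f x]; their right limit
    is the directional derivative. *)
Lemma convex_grad x y :
  convex_function [set: convex_lmodType 'cV[R]_n] f -> differentiable f x ->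
  f x + inner (grad f x) (y - x) <= f y.
Proof.
move=> cf df; rewrite -derive_grad // addrC -lerBrDr.
have /cvg_dnbhs_at_right dv := diff_derivable (v := y - x) df.
rewrite /derive -(cvg_lim _ dv) //.
apply: limr_le; first by apply/cvg_ex; eexists; exact: dv.
near=> h.
have h0 : 0 < h by near: h; exact: nbhs_right_gt.
have h1 : h <= 1 by near: h; exact: nbhs_right_le.
rewrite /= [_ *: _]mulrC ler_pdivrMr //.
have := cf (Itv01 (ltW h0) h1) y x; rewrite !inE => /(_ Logic.I Logic.I).
rewrite convRE /=.
rewrite [X in f X <= _](_ : _ = h *: (y - x) + x); last first.
  rewrite -[LHS]/(h *: y + (1 - h) *: x) scalerBl scale1r scalerBr.
  by rewrite addrCA addrC.
move=> H; rewrite lerBlDr; apply: (le_trans H).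
rewrite le_eqVlt; apply/orP; left; apply/eqP; rewrite /unstable.onem; ring.
Unshelve. all: by end_near. Qed.

(** Along a kernel direction the smoothness bound is affine, so a nonzero slope would contradict the
    lower bound; [s] is chosen to bring it down to m - 1. *)
Lemma grad_orth_ker (m : R) x z :
  one_smooth f B -> (forall y, m <= f y) -> B *m z = 0 -> inner (grad f x) z = 0.
Proof.
move=> [_ fs] mf Bz; apply/eqP; apply/negPn/negP => a0.
set a := inner _ _ in a0; pose s := (m - f x - 1) / a.
have := fs x (x + s *: z).
have -> : x + s *: z - x = s *: z by rewrite addrAC subrr add0r.
rewrite innerZr -/a.
have -> : seminorm B (s *: z) = 0.
  by rewrite /seminorm -scalemxAr Bz scaler0 innerE trmx0 mul0mx mxE sqrtr0.
rewrite expr0n mulr0 addr0 => le1; have := le_trans (mf _) le1.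
have -> : s * a = m - f x - 1 by rewrite /s; field.
by lra.
Qed.

(** For this step the linear term of the smoothness bound is minus the gain and the quadratic term
    is half the gain. *)
Lemma rcd_step_decrease x (J : {set 'I_n}) :
  psd B -> one_smooth f B -> submx_on B J \in unitmx ->
  0 <= step_gain B (grad f x) J /\
  f (rcd_step f B x J) <= f x - 2^-1 * step_gain B (grad f x) J.
Proof.
move=> psdB [_ fs] uM; set g := grad f x; set M := submx_on B J in uM *.
pose w := invmx M *m subvec_on g J.
have symM : M^T = M by rewrite /M /submx_on !trmx_mul trmxK psdB.1 mulmxA.
have hE : rcd_step f B x J - x = - (colsel J *m w).
  by rewrite /rcd_step addrAC subrr add0r /w /subvec_on !mulmxA.
have gE : inner g (colsel J *m w) = step_gain B g J.
  by rewrite innerE /step_gain /w -/M {2}/subvec_on trmx_mul trmxK !mulmxA.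
have BE : inner (B *m (colsel J *m w)) (colsel J *m w) = step_gain B g J.
  rewrite innerC innerE /step_gain -/M trmx_mul.
  have -> : w^T *m (colsel J)^T *m (B *m (colsel J *m w)) = w^T *m (M *m w).
    by rewrite /M /submx_on !mulmxA.
  by rewrite {2}/w mulKVmx // /w trmx_mul trmx_inv symM.
have gain0 : 0 <= step_gain B g J by rewrite -BE; exact: psdB.2.
split=> //; have := fs x (rcd_step f B x J).
rewrite hE innerNr gE sqr_sqrtr; last exact: psdB.2.
by rewrite mulmxN innerNl innerNr opprK BE; lra.
Qed.

End Gradient.

(** * Radius of the sublevel set *)

Section Extrema.
Variable R : realType.

Lemma set_minE (A : set R) a : A a -> lbound A a -> set_min A = a.
Proof.
move=> Aa lba; apply: xget_unique => // b [Ab lbb].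
by apply/eqP; rewrite eq_le lba // lbb.
Qed.

Lemma set_maxE (A : set R) a : A a -> ubound A a -> set_max A = a.
Proof.
move=> Aa uba; apply: xget_unique => // b [Ab ubb].
by apply/eqP; rewrite eq_le uba // ubb.
Qed.

Lemma seq_argmax (T : eqType) (m : T -> R) (x : T) (s : seq T) :
  exists2 y, y \in x :: s & forall z, z \in x :: s -> m z <= m y.
Proof.
elim: s x => [|y s IH] x.
  by exists x; rewrite ?inE // => z; rewrite inE => /eqP ->.
have [w ws wmax] := IH y; have [xw|wx] := leP (m x) (m w).
  exists w; first by rewrite inE ws orbT.
  by move=> z; rewrite inE => /predU1P[->|/wmax].
exists x; first by rewrite inE eqxx.
by move=> z; rewrite inE => /predU1P[->|/wmax zw] //; exact: le_trans zw (ltW wx).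
Qed.

(** Without a maximum the sets where m < m y, for y in K, cover K. In a finite subcover the y with
    the largest value lies in no member, a contradiction. *)
Lemma compact_usc_max (T : ptopologicalType) (m : T -> R) (K : set T) :
  compact K -> K !=set0 -> (forall a, open [set x | m x < a]) ->
  exists2 x, K x & forall y, K y -> m y <= m x.
Proof.
move=> cK [x0 Kx0] om; apply/not_exists2P => nmax.
have lt_max x : K x -> exists2 y, K y & m x < m y.
  move=> Kx; have [nKx|/existsNP[y /not_implyP[Ky /negP]]] := nmax x; first by [].
  by rewrite -ltNge => xy; exists y.
have := cK; rewrite compact_cover => /(_ T K (fun y => [set x | m x < m y])).
case=> [y _|x /lt_max[y Ky xy]|D DK Dcov]; [exact: om|by exists y|].
have [d /= dD x0d] := Dcov _ Kx0.
have [y yD ymax] := seq_argmax m d (enum_fset D).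
have {}yD : y \in D.
  by move: yD; rewrite inE => /predU1P[->|].
have [z /= zD yz] := Dcov y (set_mem (DK _ yD)).
by have := ymax z; rewrite inE zD orbT leNgt yz => /(_ isT).
Qed.

End Extrema.

Section Radius.
Variables (R : realType) (n : nat) (f : 'cV[R]_n -> R) (x0 : 'cV[R]_n).
Variable A : 'M[R]_n.
Hypotheses (cf : continuous f) (bL : bounded_set (sublevel f x0)).

Lemma closed_sublevel (y : 'cV[R]_n) : closed (sublevel f y).
Proof.
have -> : sublevel f y = f @^-1` [set r | r <= f y] by [].
by apply: preimage_closed; [move=> x _; exact: cf|exact: closed_le].
Qed.

Lemma compact_sublevel (y : 'cV[R]_n) : f y <= f x0 -> compact (sublevel f y).
Proof.
move=> yx0; apply: bounded_closed_compact_cV; last exact: closed_sublevel.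
have [M [Mreal LM]] := bL; exists M; split => // r /LM Lr x xy.
by apply: Lr; exact: le_trans xy yx0.
Qed.

Lemma ex_minimizer : exists xs, Argmin f xs.
Proof.
have L0 : sublevel f x0 !=set0 by exists x0; exact: lexx.
have [xs xsL xsmin] := compact_EVT_min L0 (compact_sublevel (lexx _))
  (continuous_subspaceT cf).
exists xs => y; have [yL|/ltW] := leP (f y) (f x0); first by apply: xsmin; rewrite inE.
by apply: le_trans; move: xsL; rewrite inE.
Qed.

Lemma compact_Argmin : compact (Argmin f).
Proof.
have [xs xsmin] := ex_minimizer.
have -> : Argmin f = sublevel f xs; last exact/compact_sublevel/xsmin.
apply/seteqP; split => [y ymin|y yxs z]; first exact: ymin.
exact: le_trans yxs (xsmin z).
Qed.

Lemma seminorm_sub_continuous (y : 'cV[R]_n) :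
  continuous (fun x : 'cV[R]_n => seminorm A (x - y)).
Proof.
have csub : continuous (fun x : 'cV[R]_n => x - y).
  by move=> x; exact: (cvgB cvg_id (cvg_cst _)).
have cq : continuous (fun x : 'cV[R]_n => inner (A *m (x - y)) (x - y)).
  by move=> x; exact: (continuous_comp (csub x) (@quadratic_continuous R n A _)).
by move=> x; exact: (continuous_comp (cq x) (@sqrt_continuous R _)).
Qed.

Let dist (x : 'cV[R]_n) : R := set_min [set seminorm A (x - xs) | xs in Argmin f].

(** Compactness of [Argmin f] makes the inner minimum attained, so [set_min] does not fall back to
    its default. *)
Lemma distP x : exists xs, [/\ Argmin f xs, dist x = seminorm A (x - xs) &
  forall y, Argmin f y -> dist x <= seminorm A (x - y)].
Proof.
have [p pP] := ex_minimizer.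
have cd : continuous (fun y : 'cV[R]_n => seminorm A (x - y)).
  have csub : continuous (fun y : 'cV[R]_n => x - y).
    by move=> y; exact: (cvgB (cvg_cst _) cvg_id).
  have cs : continuous (seminorm A).
    have -> : seminorm A = fun v => seminorm A (v - 0).
      by apply/funext => v; rewrite subr0.
    exact: seminorm_sub_continuous.
  by move=> y; exact: (continuous_comp (csub y) (cs _)).
have A0 : Argmin f !=set0 by exists p.
have [xs xsA xsmin] := compact_EVT_min A0 compact_Argmin (continuous_subspaceT cd).
rewrite inE in xsA; exists xs.
have distE : dist x = seminorm A (x - xs).
  apply: set_minE; first by exists xs.
  by move=> _ [y yA <-]; apply: xsmin; rewrite inE.
by split=> // y yA; rewrite distE; apply: xsmin; rewrite inE.
Qed.

(** A minimum of continuous functions is upper semicontinuous, which is enough for the outer maximum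
    to be attained. *)
Lemma open_dist_lt a : open [set x | dist x < a].
Proof.
have -> : [set x | dist x < a] =
    \bigcup_(y in Argmin f) [set x | seminorm A (x - y) < a].
  apply/seteqP; split => x /=.
    by have [xs [xsA -> _]] := distP x; exists xs.
  move=> [y yA /= ya]; have [xs [_ _ dmin]] := distP x.
  exact: le_lt_trans (dmin _ yA) ya.
apply: bigcup_open => y _.
have /continuousP := @seminorm_sub_continuous y.
by move=> /(_ [set r | r < a]); apply; exact: open_lt.
Qed.

Lemma sublevel_radiusP x : f x <= f x0 ->
  exists2 xs, Argmin f xs & seminorm A (x - xs) <= sublevel_radius f x0 A.
Proof.
move=> xx0.
have L0 : sublevel f x0 !=set0 by exists x0; exact: lexx.
have [z zL zmax] := compact_usc_max (compact_sublevel (lexx _)) L0 open_dist_lt.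
have -> : sublevel_radius f x0 A = dist z.
  apply: set_maxE; first by exists z.
  by move=> _ [y yL <-]; exact: zmax.
have [xs [xsA dE _]] := distP x; exists xs => //.
by rewrite -dE; exact: zmax.
Qed.

End Radius.

(** The spectral theorem makes the set under [xget] nonempty, so the selected matrix comes with a
    decomposition of its own. *)
Lemma coord_approxP (R : realType) (n tau : nat) (B : 'M[R]_n) :
  psd B -> is_coord_approx tau B (coord_approx tau B).
Proof.
move=> [symB _]; have [Q [lam [QQ slam BE]]] := spectral_sorted symB.
rewrite /coord_approx; apply: xgetPex.
by eexists; exists Q, lam; split; last reflexivity.
Qed.

(** * Finite product laws *)

Section FiniteExpectation.
Context d (T : measurableType d) (R : realType) (P : probability T R).

Lemma expectation_finite (F : finType) (Y : T -> F) (q h : F -> R) :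
  (forall s, measurable (Y @^-1` [set s])) ->
  (forall s, P (Y @^-1` [set s]) = (q s)%:E) ->
  ('E_P[(fun w => h (Y w))] = (\sum_s h s * q s)%:E)%E.
Proof.
move=> mY PY; rewrite unlock.
transitivity (\int[P]_w (\sum_s (h s)%:E * (\1_(Y @^-1` [set s]) w)%:E))%E.
  apply: eq_integral => w _; rewrite (bigD1 (Y w)) //= big1 ?adde0.
    by rewrite indicE mem_set ?mule1.
  move=> s sY; rewrite indicE memNset ?mule0 //= => Ys.
  by rewrite Ys eqxx in sY.
rewrite integral_sum //; last first.
  by move=> s; apply: integrableZl => //; exact: integrable_indic.
rewrite -sumEFin; apply: eq_bigr => s _.
rewrite integralZl //; last exact: integrable_indic.
by rewrite integral_indic // setIT EFinM -PY.
Qed.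

(** Through this lemma the sampling weights inherit nonnegativity and total mass 1 from [P], with no
    computation on determinants. *)
Lemma finite_law (F : finType) (Y : T -> F) (q : F -> R) :
  (forall s, measurable (Y @^-1` [set s])) ->
  (forall s, P (Y @^-1` [set s]) = (q s)%:E) ->
  (forall s, 0 <= q s) /\ \sum_s q s = 1.
Proof.
move=> mY PY; split=> [s|]; first by rewrite -lee_fin -PY measure_ge0.
apply: EFin_inj; rewrite -(expectation_cst P 1).
rewrite (expectation_finite (fun=> 1) mY PY).
by congr EFin; apply: eq_bigr => s _; rewrite mul1r.
Qed.

Lemma independent_joint_law (n K : nat) (X : 'I_K -> {RV P >-> {set 'I_n}})
    (p : {set 'I_n} -> R) :
  mutually_independent X -> (forall k A, P (X k @^-1` [set A]) = (p A)%:E) ->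
  let Y w := [ffun k => X k w] in
  forall s, measurable (Y @^-1` [set s]) /\
            P (Y @^-1` [set s]) = (\prod_k p (s k))%:E.
Proof.
move=> indX pX Y s.
have mX k : measurable (X k @^-1` [set s k]).
  by rewrite -[_ @^-1` _]setTI; apply: measurable_funPT.
have YE : Y @^-1` [set s] =
    \bigcap_(k in [set` (finset.setTfor 'I_K)]) (X k @^-1` [set s k]).
  apply/seteqP; split => w /=.
    by move=> <- k _; rewrite /= ffunE.
  by move=> H; apply/ffunP => k; rewrite ffunE; apply: H; rewrite /= finset.in_setT.
split.
  by rewrite YE; apply: fin_bigcap_measurable => // k _; exact: mX.
rewrite YE (indX (finset.setTfor 'I_K) (fun k => [set s k])) //.
rewrite (eq_bigr (fun k => (p (s k))%:E)) => [|k _]; last exact: pX.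
by rewrite prodEFin; congr EFin; apply: eq_bigl => k; rewrite finset.in_setT.
Qed.

End FiniteExpectation.

Section ProductWeights.
Variables (R : realType) (I X : finType) (p : X -> R).
Hypothesis p1 : \sum_A p A = 1.

Definition weight (s : {ffun I -> X}) : R := \prod_i p (s i).

Definition update (s : {ffun I -> X}) (k : I) (A : X) : {ffun I -> X} :=
  [ffun i => if i == k then A else s i].

Lemma sum_weight : \sum_s weight s = 1.
Proof.
rewrite /weight -(bigA_distr_bigA (fun _ A => p A)) /=.
by rewrite big1.
Qed.

(* Swapping the [k]-th coordinate with a fresh independent copy preserves the
   weight of the pair. *)
Lemma sum_weight_fresh (k : I) (H : {ffun I -> X} -> X -> R) :
  (forall s A, H (update s k A) = H s) ->
  \sum_s weight s * H s (s k) = \sum_s weight s * \sum_A p A * H s A.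
Proof.
move=> HU.
transitivity (\sum_(u : {ffun I -> X} * X) weight u.1 * p u.2 * H u.1 (u.1 k)).
  rewrite -(pair_bigA _ (fun s A => weight s * p A * H s (s k))) /=.
  by apply: eq_bigr => s _; rewrite -mulr_suml -mulr_sumr p1 mulr1.
pose swap (u : {ffun I -> X} * X) := (update u.1 k u.2, u.1 k).
have swapK : involutive swap.
  move=> [s A]; rewrite /swap /= ffunE eqxx; congr pair.
  by apply/ffunP => i; rewrite !ffunE; case: eqP => // ->.
rewrite (reindex_inj (inv_inj swapK)) /=.
under [RHS]eq_bigr => s _ do rewrite mulr_sumr.
rewrite pair_bigA /=; apply: eq_bigr => -[s A] _ /=.
rewrite HU ffunE eqxx mulrA; congr (_ * _).
rewrite /weight (bigD1 k) //= [in RHS](bigD1 k) //= ffunE eqxx.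
rewrite (eq_bigr (fun i => p (s i))) => [|i /negPf ik]; last by rewrite ffunE ik.
ring.
Qed.

End ProductWeights.

(** * Rate from the scalar recursion *)

Lemma weighted_step (R : realFieldType) (x a b D : R) :
  0 <= x -> 0 <= D -> a <= (x + 2) / 2 * (a - b) + D / (2 * ((x + 2) / 2)) ->
  x * (x + 1) * a <= 2 * D * x -> (x + 1) * (x + 2) * b <= 2 * D * (x + 1).
Proof.
move=> x0 D0 H IH; have e : D / (2 * ((x + 2) / 2)) = D / (x + 2) by field; lra.
have H2 : (x + 2) * b <= x * a + 2 * (D / (x + 2)) by rewrite e in H; lra.
have H3 : (x + 1) * (D / (x + 2)) <= D.
  by rewrite mulrCA ler_piMr // ler_pdivrMr ?mul1r; lra.
have H4 : (x + 1) * ((x + 2) * b) <= (x + 1) * (x * a + 2 * (D / (x + 2))).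
  by apply: ler_wpM2l => //; lra.
by lra.
Qed.

Lemma descent_rate (R : realType) (K : nat) (a : nat -> R) (D : R) :
  (0 < K)%N -> 0 <= D -> (forall k, (k <= K)%N -> 0 <= a k) ->
  (forall k t, (k < K)%N -> 0 < t -> a k <= t * (a k - a k.+1) + D / (2 * t)) ->
  forall k, (k <= K)%N -> a k <= 2 * D / k.+1%:R.
Proof.
move=> K0 D0 a0 rec.
have weighted k : (k <= K)%N -> k%:R * k.+1%:R * a k <= 2 * D * k%:R.
  elim: k => [_|k IH kK]; first by rewrite !mul0r mulr0.
  have {}IH := IH (ltnW kK).
  have t0 : 0 < (k%:R + 2) / 2 :> R by rewrite divr_gt0 // ltr_wpDl.
  have := weighted_step (ler0n R k) D0 (rec k _ kK t0).
  rewrite natr1 -[k.+2%:R]natr1 -[k.+1%:R]natr1 -addrA in IH *.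
  exact.
case=> [_|k kK].
  (* At k = 0 the weighted bound is void; the recursion with t = 1/2 and [a 1 >= 0] gives a 0 <= 2
     D. This is where K >= 1 enters. *)
  have := rec 0%N 2^-1 K0; have := a0 1%N K0; rewrite divr1.
  have -> : 2 * 2^-1 = 1 :> R by field.
  rewrite divr1 => a1 /(_ _); have : 0 < 2^-1 :> R by lra.
  by move=> h /(_ h); lra.
have k0 : 0 < k.+1%:R :> R by rewrite ltr0n.
rewrite ler_pdivlMr ?ltr0n // -(ler_pM2l k0).
by have := weighted _ kK; rewrite -mulrA [_ * a _]mulrC [leRHS]mulrC.
Qed.

(** * The iteration *)

Section Iteration.
Variables (R : realType) (n t : nat) (f : 'cV[R]_n -> R) (B : 'M[R]_n).
Hypotheses (psdB : psd B) (smoothf : one_smooth f B).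

Definition minors_sum : R := \sum_(J : {set 'I_n} | #|J| == t.+1) \det (submx_on B J).

Definition vol_prob (J : {set 'I_n}) : R :=
  if #|J| == t.+1 then \det (submx_on B J) / minors_sum else 0.

Hypotheses (prob_ge0 : forall J, 0 <= vol_prob J) (prob_sum1 : \sum_J vol_prob J = 1).

(** With a zero denominator, division would return 0 and the weights could not sum to 1. *)
Lemma minors_sum_neq0 : minors_sum != 0.
Proof.
apply/eqP => E0; have := prob_sum1; rewrite big1 => [/esym/eqP|J _].
  by rewrite oner_eq0.
by rewrite /vol_prob E0 invr0 mulr0 if_same.
Qed.

(** The factor [vol_prob J] disposes of singular blocks: there both sides are 0. *)
Lemma rcd_step_gain x J :
  vol_prob J * f (rcd_step f B x J) <=
  vol_prob J * (f x - 2^-1 * step_gain B (grad f x) J).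
Proof.
have [->|p0] := eqVneq (vol_prob J) 0; first by rewrite !mul0r.
apply: ler_wpM2l => //; have [|_ //] := rcd_step_decrease x (J := J) psdB smoothf.
rewrite unitmxE unitfE; apply: contraNneq p0.
by rewrite /vol_prob => ->; rewrite mul0r if_same.
Qed.

Lemma rcd_step_le x J : vol_prob J != 0 -> f (rcd_step f B x J) <= f x.
Proof.
move=> p0; have [|gain0 /le_trans] := rcd_step_decrease x (J := J) psdB smoothf.
  rewrite unitmxE unitfE; apply: contraNneq p0.
  by rewrite /vol_prob => ->; rewrite mul0r if_same.
by apply; rewrite lerBlDr lerDl mulr_ge0.
Qed.

Lemma sum_step_le x :
  \sum_J vol_prob J * f (rcd_step f B x J) <=
  f x - 2^-1 * \sum_(J : {set 'I_n} | #|J| == t.+1)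
                 \det (submx_on B J) / minors_sum * step_gain B (grad f x) J.
Proof.
apply: (le_trans (ler_sum _ (fun J _ => rcd_step_gain x J))).
under eq_bigr => J _ do rewrite mulrBr.
rewrite big_split /= -mulr_suml prob_sum1 mul1r lerD2l sumrN lerN2.
rewrite mulr_sumr [leLHS]big_mkcond le_eqVlt; apply/orP; left; apply/eqP.
apply: eq_bigr => J _; rewrite /vol_prob; case: ifP => _; first by rewrite mulrCA.
by rewrite mul0r.
Qed.

Hypothesis convexf : convex_function [set: convex_lmodType 'cV[R]_n] f.

(** Convexity bounds the gap by the product of the gradient with x - xs, [inner_le_gain] bounds that
    by the mean gain, and [sum_step_le] turns the gain into expected decrease. *)
Lemma expected_progress x xs s :
  Argmin f xs -> 0 < s ->
  f x - f xs <= s * (f x - \sum_J vol_prob J * f (rcd_step f B x J))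
                + seminorm (coord_approx t.+1 B) (x - xs) ^+ 2 / (2 * s).
Proof.
move=> xsmin s0; have [Q [lam [QQ _ BE AE]]] := coord_approxP t.+1 psdB.
have orth z : B *m z = 0 -> inner (grad f x) z = 0.
  by move=> Bz; exact: grad_orth_ker smoothf xsmin Bz.
have := inner_le_gain psdB QQ BE AE (x - xs) minors_sum_neq0 orth s0.
have := convex_grad xs convexf (smoothf.1 x).
rewrite -(opprB x xs) innerNr => gle gain.
have := ler_wpM2l (ltW s0) (sum_step_le x); rewrite -/minors_sum in gain *.
move: gain; set G := \sum_(J | _) _; set G1 := \sum_J _.
rewrite [_^-1 * _ ^+ 2]mulrC.
by move: gle; lra.
Qed.

Fixpoint trajectory (x0 : 'cV[R]_n) (s : nat -> {set 'I_n}) (k : nat) : 'cV[R]_n :=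
  if k is k'.+1 then rcd_step f B (trajectory x0 s k') (s k') else x0.

Lemma eq_trajectory x0 s s' k :
  (forall j, (j < k)%N -> s j = s' j) -> trajectory x0 s k = trajectory x0 s' k.
Proof.
elim: k => //= k IH ss'; rewrite ss' // IH // => j jk; apply: ss'.
exact: ltnW.
Qed.

Variables (K : nat) (x0 : 'cV[R]_n).

(** Padding by the empty set from index [K] on; the first [K] iterates and the [K]-th read only
    genuine samples. *)
Definition extend (s : {ffun 'I_K -> {set 'I_n}}) (k : nat) : {set 'I_n} :=
  if insub k is Some i then s i else finset.set0.

Lemma extendE s (k : 'I_K) : extend s k = s k.
Proof. by rewrite /extend valK. Qed.

Let W := weight (I := 'I_K) vol_prob.
Let X (s : {ffun 'I_K -> {set 'I_n}}) k := trajectory x0 (extend s) k.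

Lemma trajectory_sublevel s k : (k <= K)%N -> W s != 0 -> f (X s k) <= f x0.
Proof.
move=> kK /prodf_neq0 s0; elim: k kK => // k IH kK.
apply: le_trans (IH (ltnW kK)); rewrite /X /=.
apply: rcd_step_le; have := s0 (Ordinal kK) isT.
by rewrite -extendE.
Qed.

Lemma weight_ge0 s : 0 <= W s.
Proof. exact: prodr_ge0. Qed.

Definition gap (m : R) (k : nat) : R := \sum_s W s * (f (X s k) - m).

Lemma gap_recursion (m D s : R) (k : nat) :
  (forall x, f x <= f x0 ->
    f x - m <= s * (f x - \sum_J vol_prob J * f (rcd_step f B x J)) + D) ->
  (k < K)%N -> gap m k <= s * (gap m k - gap m k.+1) + D.
Proof.
move=> progress kK; have W1 : \sum_u W u = 1 := sum_weight _ prob_sum1.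
(* The k-th iterate depends only on samples before k, so the k-th sample may be replaced by a fresh
   copy. *)
have next : \sum_u W u * \sum_J vol_prob J * f (rcd_step f B (X u k) J) =
            \sum_u W u * f (X u k.+1).
  rewrite -(sum_weight_fresh prob_sum1 (k := Ordinal kK)
    (H := fun u J => f (rcd_step f B (X u k) J))).
    apply: eq_bigr => u _; congr (_ * f _).
    by rewrite /X /= -extendE.
  move=> u A; apply/funext => J; congr (f (rcd_step _ _ _ _)).
  apply: eq_trajectory => j jk; rewrite /extend.
  have jK : (j < K)%N := ltn_trans jk kK.
  rewrite (insubT (fun j => (j < K)%N) jK) ffunE -val_eqE /= ifN //.
  by rewrite neq_ltn jk.
(* The progress bound holds only on the sublevel set; trajectories leaving it have weight 0. *)
apply: (@le_trans _ _ (\sum_u W u * (s * (f (X u k) -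
    \sum_J vol_prob J * f (rcd_step f B (X u k) J)) + D))).
  apply: ler_sum => u _; have [->|u0] := eqVneq (W u) 0; first by rewrite !mul0r.
  apply: ler_wpM2l; first exact: weight_ge0.
  by apply/progress/trajectory_sublevel => //; exact: ltnW.
rewrite le_eqVlt; apply/orP; left; apply/eqP.
transitivity (s * (\sum_u W u * f (X u k) - \sum_u W u * f (X u k.+1)) + D).
  rewrite -next -sumrB mulr_sumr -[in RHS](mul1r D) -W1 mulr_suml -big_split /=.
  by apply: eq_bigr => u _; ring.
congr (_ * _ + _); rewrite /gap -!sumrB; apply: eq_bigr => u _; ring.
Qed.

End Iteration.

(** * Convergence of the expected gap *)

Theorem theorem3p9 (R : realType) (n : nat) (f : 'cV[R]_n -> R) (B : 'M[R]_n)
    (x0 : 'cV[R]_n) (tau K : nat)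
    (d : measure_display) (T : measurableType d) (P : probability T R)
    (S : nat -> {RV P >-> {set 'I_n}}) (x : nat -> T -> 'cV[R]_n)
    (psdB : psd B)
    (convexf : convex_function [set: convex_lmodType 'cV[R]_n] f)
    (smoothf : one_smooth f B)
    (boundedL : bounded_set (sublevel f x0))
    (tau_range : (1 <= tau <= \rank B)%N)
    (K_ge1 : (1 <= K)%N)
    (alg : RCDVS f B tau x0 K S x) :
  forall k : nat, (k <= K)%N ->
    ('E_P[(fun w => f (x k w))] - (set_min (range f))%:E <=
     (2 * sublevel_radius f x0 (coord_approx tau B) ^+ 2 / k.+1%:R)%:E)%E.
Proof.
move=> k kK; case: alg => volS indS x_0 x_S.
case: tau tau_range volS => [|t] // _ volS.
have cf : continuous f by move=> y; exact/differentiable_continuous/(smoothf.1 y).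
have [xs xsmin] := ex_minimizer cf boundedL.
have -> : set_min (range f) = f xs.
  by apply: set_minE => [|_ [y _ <-]]; [exists xs|exact: xsmin].
set D := sublevel_radius _ _ _; pose p := @vol_prob R n t B.
have pS i A : (i < K)%N -> P (S i @^-1` [set A]) = (p A)%:E.
  move=> iK; have [cardS PS] := volS i iK; rewrite /p /vol_prob.
  case: ifPn => [/eqP/PS //|At]; rewrite (_ : _ @^-1` _ = set0) ?measure0 //.
  apply/seteqP; split => // w /= SA; move: At.
  by rewrite -SA cardS eqxx.
have mS i A : measurable (S i @^-1` [set A]).
  by rewrite -[_ @^-1` _]setTI; exact: measurable_funPT.
have [p_ge0 p_sum1] := finite_law (mS 0%N) (fun A => pS 0%N A K_ge1).
pose Y w := [ffun i : 'I_K => S i w].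
have law s := independent_joint_law indS (fun i A => pS i A (ltn_ord i)) s.
have xE i w : (i <= K)%N -> x i w = trajectory f B x0 (extend (Y w)) i.
  elim: i => [|i IH] iK; first exact: x_0.
  rewrite x_S //= IH ?(ltnW iK) //.
  by rewrite -[i in extend _ i]/(val (Ordinal iK)) extendE ffunE.
(* The iterate is a function of finitely many samples, so its expectation is a finite sum with
   product weights. *)
have -> : ('E_P[(fun w => f (x k w))] - (f xs)%:E)%E = (gap t f B K x0 (f xs) k)%:E.
  pose h (s : {ffun 'I_K -> {set 'I_n}}) := f (trajectory f B x0 (extend s) k).
  have -> : (fun w => f (x k w)) = (fun w => h (Y w)).
    by apply/funext => w; rewrite xE.
  rewrite (expectation_finite h (fun s => (law s).1) (fun s => (law s).2)) -EFinB.
  congr EFin; rewrite /gap; under [RHS]eq_bigr => s _ do rewrite mulrBr.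
  rewrite sumrB -mulr_suml (sum_weight _ p_sum1) mul1r; congr (_ - _).
  by apply: eq_bigr => s _; rewrite mulrC.
rewrite lee_fin; apply: (descent_rate (K := K)) => //; first exact: sqr_ge0.
  move=> i iK; apply: sumr_ge0 => s _; apply: mulr_ge0; first exact: prodr_ge0.
  by rewrite subr_ge0.
move=> i s iK s0; apply: gap_recursion => // y yL.
have [ys ysmin ysD] := sublevel_radiusP (coord_approx t.+1 B) cf boundedL yL.
(* The minimizer realizing the distance depends on the point [y], but all minimizers share one
   value. *)
have -> : f xs = f ys by apply/eqP; rewrite eq_le xsmin ysmin.
apply: le_trans (expected_progress psdB smoothf p_ge0 p_sum1 convexf y ysmin s0) _.
rewrite lerD2l; apply: ler_wpM2r; first by rewrite invr_ge0 mulr_ge0 // ltW.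
by rewrite ler_sqr ?nnegrE ?sqrtr_ge0 // (le_trans (sqrtr_ge0 _) ysD).
Qed.
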